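(* Let $r \ge 4$ be a fixed integer. For $n \ge r$, let $G(n,r,1)$ be the graph with vertex set $[n]^{(r)}$ (all $r$-element subsets of $[n]=\{1,\dots,n\}$), in which two vertices $A,B$ are adjacent if and only if $|A\cap B|=1$, and let $G_{1/2}(n,r,1)$ be the random spanning subgraph of $G(n,r,1)$ obtained by keeping each edge independently with probability $1/2$ (equivalently, deleting each edge independently with probability $1/2$). Then $$\mathbb{P}\Big[\alpha\big(G_{1/2}(n,r,1)\big)=\alpha\big(G(n,r,1)\big)\Big]\to 1 \quad\text{as } n\to\infty,$$ where $\alpha(\cdot)$ denotes the independence number. *)

(* Defs.v *)
From mathcomp Require Import all_boot all_order all_algebra.
Set Implicit Arguments. Unset Strict Implicit. Unset Printing Implicit Defensive.
Import Order.TTheory GRing.Theory Num.Theory.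

Definition Kvert (n r : nat) : {set {set 'I_n}} := [set A : {set 'I_n} | #|A| == r].

Definition Kedges (n r : nat) : {set {set {set 'I_n}}} :=
  [set [set A; B] | A in Kvert n r, B in Kvert n r & #|A :&: B| == 1%N].

Definition indep n r (S : {set {set {set 'I_n}}}) (I : {set {set 'I_n}}) : bool :=
  (I \subset Kvert n r) && [forall A in I, forall B in I, [set A; B] \notin S].

Definition alpha n r (S : {set {set {set 'I_n}}}) : nat :=
  \max_(I : {set {set 'I_n}} | indep r S I) #|I|.

(* P[ alpha(G_{1/2}(n,r,1)) = alpha(G(n,r,1)) ]: keeping each edge independently
   with probability 1/2 is the uniform distribution on subsets of the edge set. *)
Definition prob_alpha_eq (n r : nat) : rat :=
  (#|[set S in powerset (Kedges n r) | alpha r S == alpha r (Kedges n r)]|%:R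
    / (2 ^ #|Kedges n r|)%:R)%R.

(* Main.v *)
Require Import Defs.
From mathcomp Require Import all_boot all_order all_algebra zify.
Import Order.TTheory GRing.Theory Num.Theory.
Set Implicit Arguments. Unset Strict Implicit. Unset Printing Implicit Defensive.

(** Put M = C(n-2, r-2), the number of r-sets containing a fixed pair. Such a
    star is independent in every subgraph, so it suffices that with high
    probability no independent family F of the random graph has more than M
    members. Only two properties of the random graph matter, and both follow
    from a union bound: with t of order log n, every K_{t,t} of G(n,r,1) keeps
    an edge; and every r-set B keeps at least 1/8 of its edges to the r-sets
    containing K, whenever |K| = 3 and |K :&: B| = 1.

    Call K fat if the link of K in F has no transversal of at most s points,
    where s is a large multiple of log n. By the first property two fat sets of
    fewer than r elements never meet in exactly one point. A set has only
    polylogarithmically many minimal fat supersets, so all but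
    n^(r-3) polylog(n) members A of F have few minimal fat sets above each
    small subset of A; for these A, either A contains a fat pair P with x |: P
    fat for all x in A, or r = 4 and A is the union of two fat pairs. Fat
    pairs, together with their territories {x | x |: P fat}, are disjoint, so
    if #|F| > M then one pair P has almost all points in its territory and F
    contains almost all of the star of P. By the second property the members
    of F outside the star live on the small set Z of points x such that F
    misses many supersets of x |: P. There are about |Z|^(r-2) of them, fewer
    than the order of |Z| n^(r-3) members of the star that F must miss. *)

(** * Cardinalities of finite sets and powers *)

Lemma exists_subset_card (T : finType) (A K : {set T}) k :
  K \subset A -> #|K| <= k <= #|A| ->
  exists R : {set T}, [/\ K \subset R, R \subset A & #|R| = k].
Proof.
move=> KA /andP[hK hA].
have: 0 < #|[set Y : {set T} | Y \subset A :\: K & #|Y| == k - #|K|]|.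
  by rewrite cards_draws bin_gt0 cardsD (setIidPr KA); lia.
case/card_gt0P => Y; rewrite inE subsetD => /andP[/andP[YA dY] /eqP hY].
exists (K :|: Y); split; first exact: subsetUl.
  by rewrite subUset KA YA.
by rewrite cardsU hY setIC (disjoint_setI0 dY) cards0; lia.
Qed.

Lemma card_bigcup_leq (T I : finType) (P : pred I) (E : I -> {set T}) :
  #|\bigcup_(i | P i) E i| <= \sum_(i | P i) #|E i|.
Proof.
elim/big_rec2: _ => [|i n X _ le]; first by rewrite cards0.
by apply: leq_trans (leq_card_setU _ _) _; rewrite leq_add2l.
Qed.

Lemma ffact_leq_exp n k : n ^_ k <= n ^ k.
Proof.
elim: k => [|k IH]; first by rewrite ffactn0.
by rewrite ffactnSr expnSr leq_mul // leq_subr.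
Qed.

Lemma bin_leq_exp n k : 'C(n, k) <= n ^ k.
Proof.
apply: leq_trans (ffact_leq_exp n k).
by rewrite -bin_ffact leq_pmulr // fact_gt0.
Qed.

(** * Fat sets *)

Section Fat.
Variables (T : finType) (F : {set {set T}}) (r s : nat).
Hypothesis F_unif : forall A, A \in F -> #|A| = r.
Implicit Types A B C K L V W X Y : {set T}.

Definition fat K : bool :=
  [forall C : {set T}, (#|C| <= s) ==>
     [exists A in F, (K \subset A) && [disjoint A :\: K & C]]].

Lemma fatP K : reflect
  (forall C, #|C| <= s ->
     exists2 A, A \in F & K \subset A /\ [disjoint A :\: K & C])
  (fat K).
Proof.
apply: (iffP forallP) => [h C hC | h C].
  move: (h C); rewrite hC => /exists_inP[A AF /andP[KA dA]].
  by exists A.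
apply/implyP => hC; have [A AF [KA dA]] := h C hC.
by apply/exists_inP; exists A => //; rewrite KA.
Qed.

Lemma fat_mem A : A \in F -> fat A.
Proof.
move=> AF; apply/fatP => C _; exists A => //; split=> //.
by rewrite setDv -setI_eq0 set0I.
Qed.

Lemma fat_ext K : fat K -> exists2 A, A \in F & K \subset A.
Proof.
by move/fatP/(_ set0); rewrite cards0 => /(_ isT)[A AF [KA _]]; exists A.
Qed.

Lemma fat_card K : fat K -> #|K| <= r.
Proof. by case/fat_ext => A AF KA; rewrite -(F_unif AF) subset_leq_card. Qed.

(* A transversal witnessing that K is not fat also meets every fat superset of K,
   so minimal fat supersets can be enumerated by branching on its points. *)
Lemma nonfat_cover K : ~~ fat K ->
  exists2 C : {set T}, #|C| <= s &
    forall L, fat L -> K \subset L -> exists2 c : T, c \in C & c \in L :\: K.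
Proof.
rewrite negb_forall => /existsP[C]; rewrite negb_imply => /andP[hC hF].
exists C => // L /fatP/(_ C hC)[A AF [LA dA]] KL.
have KA := subset_trans KL LA.
move/exists_inPn/(_ _ AF): hF; rewrite KA /= disjoint_subset => /subsetPn[c].
rewrite !inE negbK => /andP[cK cA] cC; exists c => //.
rewrite !inE cK /=; apply: contraT => cL.
by move: dA => /disjointFr/(_ _); move=> /(_ c); rewrite !inE cL cA cC => /(_ isT).
Qed.

Definition fat_above K L : bool := (K \subset L) && fat L.

Definition hull K : {set T} :=
  (\bigcup_(L | minset (fat_above K) L) L) :\: K.

Lemma min_fat_hull K L : minset (fat_above K) L -> L \subset K :|: hull K.
Proof.
move=> mL; apply/subsetP => x xL; rewrite !inE; case: (x \in K) => //=.
by apply/bigcupP; exists L.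
Qed.

Lemma min_fat_above_add K L c :
  minset (fat_above K) L -> c \in L -> minset (fat_above (c |: K)) L.
Proof.
move=> /minsetP[/andP[KL fL] mL] cL; apply/minsetP; split.
  by rewrite /fat_above fL subUset sub1set cL KL.
move=> B /andP[cKB fB] BL; apply: mL => //; rewrite /fat_above fB andbT.
exact: subset_trans (subsetUr _ _) cKB.
Qed.

(** Induction on the room [j] left below size [r]. A fat [K] is its own only minimal fat superset;
    otherwise each [L] contains one of at most [s] transversal points [c] and stays minimal above
    [c |: K]. The sizes fit since [s + s * (s.+1 ^ j - 1) < s.+1 ^ j.+1]. *)
Lemma card_hull_rec j K : r <= #|K| + j ->
  exists2 V : {set T}, #|V| < s.+1 ^ j &
    forall L, minset (fat_above K) L -> L \subset K :|: V.
Proof.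
elim: j K => [|j IH] K hK.
  exists set0 => [|L /minsetP[/andP[KL fL] _]]; first by rewrite cards0.
  rewrite setU0; have/eqP-> : K == L; last by [].
  rewrite eqEcard KL /=; apply: leq_trans (fat_card fL) _.
  by rewrite addn0 in hK.
case: (boolP (fat K)) => [fK | nfK].
  exists set0 => [|L /minsetP[/andP[KL fL] mL]]; first by rewrite cards0 expn_gt0.
  by rewrite -(mL K) ?subsetUl // /fat_above fK subxx.
have [C hC hcov] := nonfat_cover nfK.
have /fin_all_exists2[V hV1 hV2] : forall c : T, exists2 V : {set T},
    #|V| < s.+1 ^ j & c \notin K ->
    forall L, minset (fat_above (c |: K)) L -> L \subset (c |: K) :|: V.
  move=> c; case: (boolP (c \in K)) => [_ | cK].
    by exists set0 => //; rewrite cards0 expn_gt0.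
  have [|V h1 h2] := IH (c |: K); last by exists V.
  by rewrite cardsU1 cK; lia.
exists (C :|: \bigcup_(c in C) V c) => [|L mL].
  have: #|\bigcup_(c in C) V c| <= #|C| * (s.+1 ^ j).-1.
    apply: leq_trans (card_bigcup_leq _ _) _.
    rewrite -sum_nat_const; apply: leq_sum => c _.
    by have := hV1 c; lia.
  have := leq_card_setU C (\bigcup_(c in C) V c) => -[h _].
  rewrite expnS; set e := s.+1 ^ j in hV1 *; have e0: 0 < e by rewrite expn_gt0.
  by move=> h'; nia.
have /andP[KL fL] := minsetp mL.
have [c cC] := hcov L fL KL; rewrite inE => /andP[cK cL].
apply: subset_trans (hV2 c cK L (min_fat_above_add mL cL)) _.
apply/subsetP => x; rewrite !inE => /orP[/orP[/eqP->|->]|xV] //.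
  by rewrite cC orbT.
by apply/orP; right; apply/orP; right; apply/bigcupP; exists c.
Qed.

Lemma card_hull K : #|hull K| < s.+1 ^ r.
Proof.
have [|V hV hm] := @card_hull_rec r K; first exact: leq_addl.
apply: leq_ltn_trans hV; apply: subset_leq_card.
apply/subsetP => x; rewrite inE => /andP[xK /bigcupP[L mL xL]].
by have /subsetP/(_ x xL) := hm L mL; rewrite inE (negPf xK).
Qed.

Lemma exists_min_fat K L : K \subset L -> fat L ->
  exists2 M, minset (fat_above K) M & M \subset L.
Proof.
move=> KL fL; have [|M h1 h2] := @minset_exists _ (fat_above K) L.
  by rewrite /fat_above KL.
by exists M.
Qed.

(* At most two points of A lie in minimal fat sets above a small subset of A:
   three such points together with r - 3 others would determine A up to
   few choices. *)
Definition good_mem A : bool :=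
  (A \in F) && [forall (K : {set T} | (K \subset A) && (#|K| <= r - 3)),
                  #|A :&: hull K| <= 2].

Lemma good_memW A : good_mem A -> A \in F. Proof. by case/andP. Qed.

Lemma good_hull A K : good_mem A -> K \subset A -> #|K| <= r - 3 ->
  #|A :&: hull K| <= 2.
Proof. by case/andP=> _ /forall_inP h KA hK; apply: h; rewrite KA. Qed.

(** [A] is itself fat, so a minimal fat set above [K] lies in [A], hence adds to [K] only points of
    [A :&: hull K]. *)
Lemma good_fat A K : good_mem A -> K \subset A -> #|K| <= r - 3 ->
  exists L, [/\ fat L, K \subset L, L \subset A & #|L| <= #|K| + 2].
Proof.
move=> gA KA hK; have [L mL LA] := exists_min_fat KA (fat_mem (good_memW gA)).
have /andP[KL fL] := minsetp mL; exists L; split=> //.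
have: L \subset K :|: (A :&: hull K).
  apply/subsetP => x xL; rewrite in_setU in_setI (subsetP LA _ xL) /=.
  by move/subsetP: (min_fat_hull mL) => /(_ x xL); rewrite in_setU.
move/subset_leq_card/leq_trans; apply; apply: leq_trans (leq_card_setU _ _) _.
by rewrite leq_add2l good_hull.
Qed.

(** A bad [A] is [R :|: X] with [X] three points of [hull K]; as [hull K] avoids [K], still
    [K \subset R]. The factors count the choices of [R], of [K] inside [R], and of [X]. *)
Lemma card_bad_mem : 3 <= r ->
  #|[set A in F | ~~ good_mem A]| <= #|T| ^ (r - 3) * (2 ^ r * (s.+1 ^ r) ^ 3).
Proof.
move=> r3.
pose E (K R : {set T}) :=
  [set R :|: X | X in [set X : {set T} | X \subset hull K & #|X| == 3]].
have sub : [set A in F | ~~ good_mem A] \subset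
    \bigcup_(R : {set T} | #|R| == r - 3) \bigcup_(K : {set T} | K \subset R) E K R.
  apply/subsetP => A; rewrite inE => /andP[AF].
  rewrite /good_mem AF /= negb_forall => /existsP[K].
  rewrite negb_imply -ltnNge => /andP[/andP[KA hK] hA].
  have [|X [_ XA hX]] := @exists_subset_card _ (A :&: hull K) set0 3 (sub0set _).
    by rewrite cards0.
  have [XA1 XA2] : X \subset A /\ X \subset hull K.
    by apply/andP; rewrite -subsetI.
  apply/bigcupP; exists (A :\: X); first by rewrite cardsD (setIidPr XA1) hX F_unif.
  apply/bigcupP; exists K.
    apply/subsetP => x xK; rewrite inE (subsetP KA) // andbT.
    by apply/negP => /(subsetP XA2); rewrite inE xK.
  apply/imsetP; exists X; first by rewrite inE XA2 hX.
  apply/setP => x; rewrite !inE.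
  by case: (boolP (x \in X)) => [/(subsetP XA1) -> | _]; rewrite ?orbF.
apply: leq_trans (subset_leq_card sub) _.
apply: leq_trans (card_bigcup_leq _ _) _.
apply: (@leq_trans (\sum_(R : {set T} | #|R| == r - 3) 2 ^ r * (s.+1 ^ r) ^ 3)).
  apply: leq_sum => R /eqP hR; apply: leq_trans (card_bigcup_leq _ _) _.
  apply: (@leq_trans (\sum_(K : {set T} | K \subset R) (s.+1 ^ r) ^ 3)).
    apply: leq_sum => K _; apply: leq_trans (leq_imset_card _ _) _.
    rewrite cards_draws; apply: leq_trans (bin_leq_exp _ _) _.
    by rewrite leq_exp2r // ltnW // card_hull.
  rewrite (eq_bigl (fun K => K \in powerset R)) => [|K]; last by rewrite powersetE.
  by rewrite sum_nat_const card_powerset hR leq_mul2r leq_exp2l // leq_subr orbT.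
rewrite (eq_bigl (fun R => R \in [set R : {set T} | #|R| == r - 3])) => [|R];
  last by rewrite inE.
by rewrite sum_nat_const card_draws leq_mul2r bin_leq_exp orbT.
Qed.

(** * Intersections of fat sets and the structure of good members *)

Section Intersections.
Variable t : nat.
Hypothesis F_biclique_free : forall X Y : {set {set T}},
  X \subset F -> Y \subset F -> #|X| = t -> #|Y| = t ->
  ~ (forall A B, A \in X -> B \in Y -> #|A :&: B| = 1).
Hypothesis t_small : r + 2 * (r * t) <= s.

(** Greedy choice: fatness of [K], applied to [W] together with all sets chosen so far, yields the
    next one. *)
Lemma fat_family K W j : fat K -> #|K| < r -> #|W| + r * j <= s ->
  exists X : {set {set T}}, [/\ X \subset F, #|X| = j &
    forall A, A \in X -> K \subset A /\ [disjoint A :\: K & W]].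
Proof.
move=> fK hK; elim: j => [|j IH] hW.
  by exists set0; rewrite sub0set cards0; split=> // A; rewrite inE.
have [|X [XF hX XK]] := IH; first by lia.
have [|A AF [KA dA]] := fatP _ fK (W :|: \bigcup_(B in X) B).
  apply: leq_trans (leq_card_setU _ _) _.
  have: #|\bigcup_(B in X) B| <= #|X| * r.
    apply: leq_trans (card_bigcup_leq _ _) _; rewrite -sum_nat_const.
    by apply: leq_sum => B BX; rewrite (F_unif (subsetP XF _ BX)).
  by rewrite hX; nia.
(* A point of [A] outside [K] lies in no earlier set, so [A] is new. *)
have [a aA aK] : exists2 a, a \in A & a \notin K.
  by apply/subsetPn; apply: contraTN hK => /subset_leq_card; rewrite F_unif // -leqNgt.
have notW x : x \in A -> x \notin K -> x \notin W :|: \bigcup_(B in X) B.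
  by move=> xA xK; rewrite (disjointFr dA) // inE xK.
have AX : A \notin X.
  apply/negP => AX; have := notW _ aA aK; rewrite inE negb_or => /andP[_ /bigcupP[]].
  by exists A.
exists (A |: X); split; first by rewrite subUset sub1set AF.
  by rewrite cardsU1 AX hX.
move=> B; rewrite !inE => /orP[/eqP->|/XK //]; split=> //.
by apply: disjointWr dA; apply: subsetUl.
Qed.

(** Otherwise take [t] members above [K] that avoid [L] outside [K], then [t] members above [L] that
    avoid all of these outside [L]. Every cross intersection is then [K :&: L], which gives a
    forbidden biclique. *)
Lemma fat_inter K L : fat K -> fat L -> #|K| < r -> #|L| < r -> #|K :&: L| != 1.
Proof.
move=> fK fL hK hL; apply/eqP => h1.
have [|X [XF hX XK]] := fat_family (W := L) (j := t) fK hK; first by lia.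
have hU : #|\bigcup_(B in X) B| <= t * r.
  apply: leq_trans (card_bigcup_leq _ _) _; rewrite -hX -sum_nat_const.
  by apply: leq_sum => B BX; rewrite (F_unif (subsetP XF _ BX)).
have [|Y [YF hY YL]] := fat_family (W := \bigcup_(B in X) B) (j := t) fL hL.
  by lia.
apply: (F_biclique_free XF YF hX hY) => A B AX BY.
have [KA dA] := XK A AX; have [LB dB] := YL B BY.
rewrite -h1; congr #|pred_of_set _|; apply/eqP; rewrite eqEsubset andbC setISS //=.
apply/subsetP => x; rewrite !inE => /andP[xA xB].
have xL : x \in L.
  apply: contraT => xL; have := disjointFr dB (x := x); rewrite inE xL xB => /(_ isT).
  by move/negbT/negP; case; apply/bigcupP; exists A.
rewrite xL andbT; apply: contraT => xK.
by have := disjointFr dA (x := x); rewrite inE xK xA xL => /(_ isT).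
Qed.

(** [fat_inter] with both sets equal excludes fat singletons. *)
Lemma fat_card_gt1 K x : fat K -> x \in K -> #|K| < r -> 1 < #|K|.
Proof.
move=> fK xK hK; have := fat_inter fK fK hK hK; rewrite setIid.
by have : 0 < #|K| by [apply/card_gt0P; exists x]; lia.
Qed.

Hypothesis r_ge4 : 4 <= r.

(** The minimal fat sets above [[set x]] inside [A] all lie in [Q], of at most three points, where
    [fat_inter] leaves room for only one. *)
Lemma good_core A x : good_mem A -> x \in A ->
  exists m, [/\ fat m, x \in m, m \subset A, 1 < #|m| <= 3 &
    forall L, fat L -> x \in L -> L \subset A -> m \subset L].
Proof.
move=> gA xA; pose K := [set x]; have KA : K \subset A by rewrite sub1set.
pose Q := K :|: (A :&: hull K).
have hQ : #|Q| <= 3.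
  apply: leq_trans (leq_card_setU _ _) _; rewrite cards1 leq_add2l.
  by apply: good_hull => //; rewrite cards1; lia.
have minQ L : minset (fat_above K) L -> L \subset A ->
    [/\ fat L, x \in L, L \subset Q, 1 < #|L| & #|L| <= 3].
  move=> mL LA; have /andP[] := minsetp mL; rewrite sub1set => xL fL.
  have LQ : L \subset Q.
    apply/subsetP => y yL; rewrite in_setU in_setI (subsetP LA _ yL) /=.
    by move/subsetP: (min_fat_hull mL) => /(_ y yL); rewrite in_setU.
  have h3 := leq_trans (subset_leq_card LQ) hQ.
  by split=> //; apply: fat_card_gt1 xL _ => //; lia.
have [m mm mA] := exists_min_fat KA (fat_mem (good_memW gA)).
have [fm xm mQ m1 m3] := minQ m mm mA.
exists m; split=> //; first by rewrite m1.
move=> L fL xL LA; have [|L0 mL0 L0L] := exists_min_fat (K := K) _ fL.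
  by rewrite sub1set.
have [f0 x0 Q0 l1 l3] := minQ L0 mL0 (subset_trans L0L LA).
suff <- : L0 = m by [].
case: (boolP (m \subset L0)) => [ml|nml].
  by have /minsetP[_ h] := mL0; rewrite -(h m) //; have := minsetp mm.
have /minsetP[_ h] := mm; apply: h; first exact: minsetp mL0.
have lt : #|m :&: L0| < #|m|.
  by apply: proper_card; rewrite properE subsetIl subsetI subxx.
have := fat_inter fm f0 (leq_ltn_trans m3 r_ge4) (leq_ltn_trans l3 r_ge4).
have : 0 < #|m :&: L0| by apply/card_gt0P; exists x; rewrite inE xm.
(* The intersection has at least two points and [m] has more, so [m] has three and exhausts [Q],
   which contains [L0]. *)
move=> h0 h1; suff/eqP-> : m == Q by [].
by rewrite eqEcard mQ (leq_trans hQ) //; move: lt h0 h1; clear; lia.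
Qed.

(** Let [m x] be the least fat set through [x] inside [A]. If some [m z] has three points,
    [m z :\ z] is the required pair. If all are pairs, they partition [A], and there is no room for
    a third. *)
Lemma good_structure A : good_mem A ->
  (exists P, [/\ fat P, #|P| = 2, P \subset A &
     forall x, x \in A -> x \notin P -> fat (x |: P)]) \/
  (r = 4 /\ exists P Q, [/\ fat P, fat Q, #|P| = 2, #|Q| = 2 &
     [disjoint P & Q] /\ A = P :|: Q]).
Proof.
move=> gA; have hA : #|A| = r by apply: F_unif; apply: good_memW.
have /fin_all_exists[m hm] : forall x, exists m, x \in A ->
    [/\ fat m, x \in m, m \subset A, 1 < #|m| <= 3 &
      forall L, fat L -> x \in L -> L \subset A -> m \subset L].
  move=> x; case: (boolP (x \in A)) => [xA|_]; last by exists set0.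
  by have [mx h] := good_core gA xA; exists mx.
have mfat x : x \in A -> fat (m x) by move=> /hm[].
have mmem x : x \in A -> x \in m x by move=> /hm[].
have msub x : x \in A -> m x \subset A by move=> /hm[].
have mc x : x \in A -> 1 < #|m x| <= 3 by move=> /hm[].
have mmin x L : x \in A -> fat L -> x \in L -> L \subset A -> m x \subset L.
  by move=> /hm[? ? ? ? h]; apply: h.
have mlt x : x \in A -> #|m x| < r by move=> /mc; lia.
have mm x y : x \in A -> y \in m x -> m y \subset m x.
  move=> xA yx; apply: mmin => //; [exact: subsetP (msub _ xA) _ yx | exact: mfat|exact: msub].
have outside (X : {set T}) : #|X| < r -> exists2 w, w \in A & w \notin X.
  by move=> hX; apply/subsetPn; apply: contraTN hX => /subset_leq_card; rewrite hA -leqNgt.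
case: (boolP [exists z in A, #|m z| == 3]) => [/exists_inP[z zA /eqP z3]|no3].
  left; pose P := m z :\ z.
  have P2 : #|P| = 2 by have := cardsD1 z (m z); rewrite mmem // z3 /P; lia.
  have zP : z |: P = m z by rewrite setD1K // mmem.
  have mw w : w \in A -> w \notin m z -> m w = w |: P.
    (* Within four points, sets of sizes three and at least two share a point, hence two points by
       [fat_inter]. The four points come from [good_fat] above [[set z; w]], or are [A] itself if
       [r = 4]. *)
    move=> wA wz; have u4 : #|m z :|: m w| <= 4.
      have [r5|r4] := leqP 5 r; last first.
        apply: (@leq_trans #|A|); last by lia.
        by apply: subset_leq_card; rewrite subUset !msub.
      have [||L [fL KL LA hL]] := good_fat (K := [set z; w]) gA.
      - by rewrite subUset !sub1set zA.
      - by rewrite cards2; lia.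
      have [zL wL] : z \in L /\ w \in L.
        by apply/andP; move: KL; rewrite subUset !sub1set.
      apply: (@leq_trans #|L|); first by apply: subset_leq_card; rewrite subUset !mmin.
      by apply: leq_trans hL _; rewrite cards2; lia.
    have := fat_inter (mfat z zA) (mfat w wA) (mlt z zA) (mlt w wA).
    have := cardsUI (m z) (m w); have := mc w wA; have := mmem w wA.
    move=> ww w13 cu ci.
    have c2 : #|m z :&: m w| = 2 /\ #|m w| = 3.
      have wn : m z :&: m w \subset m w :\ w.
        apply/subsetP => y; rewrite !inE => /andP[yz ->]; rewrite andbT.
        by apply: contraNneq wz => <-.
      have := subset_leq_card wn; have := cardsD1 w (m w); rewrite ww; lia.
    have znw : z \notin m w.
      apply/negP => zw; have := mm w z wA zw => zsub.
      have/eqP e : m z == m w by rewrite eqEcard zsub; lia.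
      by rewrite e ww in wz.
    have eP : m z :&: m w = P.
      apply/eqP; rewrite eqEcard P2; apply/andP; split; last by lia.
      apply/subsetP => y; rewrite !inE => /andP[yz yw]; rewrite yz andbT.
      by apply: contraNneq znw => <-.
    apply/eqP; rewrite eq_sym eqEcard subUset sub1set ww -eP subsetIr /=.
    by rewrite cardsU1 inE (negPf wz) /=; lia.
  have [w wA wz] := outside (m z) (mlt z zA).
  have [x xP] : exists x, x \in P by apply/card_gt0P; rewrite P2.
  have xz : x \in m z by rewrite -zP inE xP orbT.
  have xA : x \in A by apply: subsetP (msub z zA) _ xz.
  have xw : x \in m w by rewrite mw // inE xP orbT.
  (* For [x] in [P], [m x] lies in both [m z] and [m w], which meet in [P]; this is why [P] is
     fat. *)
  have eP : m x = P.
    apply/eqP; rewrite eqEcard P2; have /andP[-> _] := mc x xA; rewrite andbT.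
    apply/subsetP => y yx; have := subsetP (mm z x zA xz) y yx.
    have := subsetP (mm w x wA xw) y yx.
    rewrite mw // -zP !in_setU1 => /orP[/eqP->|-> //] /orP[/eqP wz'|//].
    by rewrite wz' mmem in wz.
  exists P; rewrite -{1}eP; split=> //; first exact: mfat.
    by apply: subset_trans (msub z zA); rewrite -zP subsetUr.
  move=> y yA yP; case: (boolP (y \in m z)) => [|yz]; last by rewrite -mw //; apply: mfat.
  by rewrite -zP in_setU1 (negPf yP) orbF => /eqP->; rewrite zP; apply: mfat.
right; have m2 x : x \in A -> #|m x| = 2.
  move=> xA; have := mc x xA; have := exists_inPn no3 x xA; lia.
have disj x y : x \in A -> y \in A -> y \notin m x -> [disjoint m x & m y].
  move=> xA yA yx; apply/pred0P => u /=; apply: contraNF yx => /andP[ux uy].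
  have uA := subsetP (msub x xA) u ux.
  have/eqP ex : m u == m x by rewrite eqEcard mm // !m2.
  have/eqP ey : m u == m y by rewrite eqEcard mm // !m2.
  by rewrite -ex ey mmem.
have [|x xA _] := outside set0; first by rewrite cards0 (ltn_trans _ r_ge4).
have [w wA wx] := outside (m x) (mlt x xA).
have dxw := disj x w xA wA wx.
have c4 : #|m x :|: m w| = 4.
  by rewrite cardsU (disjoint_setI0 dxw) cards0 !m2.
have [r5|r4] := ltnP 4 r; last first.
  split; first by lia.
  exists (m x), (m w); split; rewrite ?mfat ?m2 //; split=> //.
  by apply/eqP; rewrite eq_sym eqEcard subUset !msub // hA c4.
(* A third pair needs six points: too many for [r = 5], and for larger [r] more than the five
   allowed by [good_fat] above [[set x; w; u]]. *)
have [|u uA] := outside (m x :|: m w); first by rewrite c4.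
rewrite inE negb_or => /andP[ux uw].
have c6 : #|m x :|: m w :|: m u| = 6.
  rewrite cardsU c4 m2 // setIUl (disjoint_setI0 (disj x u xA uA ux)).
  by rewrite (disjoint_setI0 (disj w u wA uA uw)) setU0 cards0.
have [r6|] := leqP 6 r; last first.
  have : #|m x :|: m w :|: m u| <= #|A|.
    by apply: subset_leq_card; rewrite !subUset !msub.
  by lia.
have K3 : #|[set x; w; u]| <= 3.
  by apply: leq_trans (leq_card_setU _ _) _; rewrite cards2 cards1; case: (x != w).
have [||L [fL KL LA hL]] := good_fat (K := [set x; w; u]) gA.
- by rewrite !subUset !sub1set xA wA uA.
- by apply: leq_trans K3 _; move: r6; clear; lia.
have [[xL wL] uL] : (x \in L /\ w \in L) /\ u \in L.
  by move: KL; rewrite !subUset !sub1set => /andP[/andP[-> ->] ->].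
have L6 : 6 <= #|L|.
  by rewrite -c6; apply: subset_leq_card; rewrite !subUset !mmin.
by have := leq_trans (leq_trans L6 hL) (leq_add K3 (leqnn 2)).
Qed.

End Intersections.

End Fat.

(** * Counting edge sets by their trace *)

(** [S] corresponds to its parts inside and outside [E0]: an event about [E0] has the same
    probability when only the edges of [E0] are random. *)
Lemma card_subsets_by_trace (T : finType) (E E0 : {set T}) (Q : pred {set T}) :
  E0 \subset E ->
  #|[set S in powerset E | Q (S :&: E0)]| =
  #|[set X in powerset E0 | Q X]| * 2 ^ (#|E| - #|E0|).
Proof.
move=> sE; have <- : #|E :\: E0| = #|E| - #|E0| by rewrite cardsD (setIidPr sE).
rewrite -card_powerset -cardsX.
have inj : {in [set S in powerset E | Q (S :&: E0)] &,
    injective (fun S : {set T} => (S :&: E0, S :\: E0))}.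
  by move=> S S' _ _ [e1 e2]; rewrite -(setID S E0) e1 e2 setID.
rewrite -(card_in_imset inj); congr #|pred_of_set _|; apply/setP => -[X Y].
rewrite !inE /=; apply/imsetP/andP => [[S] | [/andP[XE QX] YE]].
  rewrite !inE => /andP[SE QS] [-> ->]; rewrite subsetIr QS; split=> //.
  by apply: setSD.
move: YE; rewrite subsetD => /andP[YE dY].
have eX : (X :|: Y) :&: E0 = X.
  by rewrite setIUl (setIidPl XE) (disjoint_setI0 dY) setU0.
exists (X :|: Y); rewrite ?inE ?eX.
  by rewrite subUset YE QX !andbT (subset_trans XE).
congr (_, _); rewrite setDUl (setDidPl dY).
by move: XE; rewrite -setD_eq0 => /eqP->; rewrite set0U.
Qed.

Lemma card_lower_tail (T : finType) (E : {set T}) a :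
  #|[set X in powerset E | #|X| <= a]| * 3 ^ #|E| <= 3 ^ a * 4 ^ #|E|.
Proof.
(* Chernoff: weigh each X by 3 ^ (#|E| - #|X|). *)
have -> : 4 ^ #|E| = \sum_(X in powerset E) 3 ^ (#|E| - #|X|).
  rewrite (_ : 4 = 3 + 1) // expnDn.
  (* Grouping by cardinality recovers the binomial expansion of the power. *)
  rewrite (partition_big (fun X : {set T} => inord #|X| : 'I_#|E|.+1) xpredT) //=.
  apply: eq_bigr => i _; rewrite exp1n muln1.
  have e (X : {set T}) : ((X \in powerset E) && (inord #|X| == i :> 'I_#|E|.+1)) =
      (X \in [set X : {set T} | X \subset E & #|X| == i]).
    rewrite !inE; case: (boolP (X \subset E)) => //= /subset_leq_card hX.
    by rewrite -val_eqE /= inordK.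
  rewrite (eq_bigl _ _ e) -cards_draws -sum_nat_const; apply: eq_bigr => X.
  by rewrite inE => /andP[_ /eqP->].
rewrite big_distrr /= -sum_nat_const [leqRHS](bigID (fun X : {set T} => #|X| <= a)) /=.
apply: leq_trans (leq_addr _ _).
rewrite (eq_bigl (fun X : {set T} => (X \in powerset E) && (#|X| <= a))); last first.
  by move=> X; rewrite !inE.
apply: leq_sum => X; rewrite powersetE => /andP[/subset_leq_card hX hXa].
by rewrite -expnD leq_exp2l //; lia.
Qed.

Lemma card_eighth_tail (T : finType) (E : {set T}) :
  #|[set X in powerset E | 8 * #|X| < #|E|]| * 2 ^ (#|E|.-1 %/ 8) <= 2 ^ #|E|.
Proof.
have [->|E0] := eqVneq E set0.
  rewrite (_ : [set _ in _ | _] = set0) ?cards0 //.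
  by apply/setP => X; rewrite !inE ltn0 andbF.
have N0 : 0 < #|E| by rewrite card_gt0.
set N := #|E| in N0 *; set a := N.-1 %/ 8.
have -> : [set X in powerset E | 8 * #|X| < N] = [set X in powerset E | #|X| <= a].
  apply/setP => X; rewrite !inE; case: (boolP (X \subset E)) => //= /subset_leq_card.
  by rewrite -/N /a => _; apply/idP/idP; lia.
have aN : 8 * a <= N by rewrite /a; lia.
have := card_lower_tail E a; rewrite -/N; set c := #|_| => h.
(* Eight elements at a time: [6 * 2 ^ 8 <= 3 ^ 8]. The surplus of 6 over the factor 3 of
   [card_lower_tail] is the gain [2 ^ a]. *)
have p6 : 6 ^ a * 2 ^ N <= 3 ^ N.
  have [k ->] : exists k, N = 8 * a + k by exists (N - 8 * a); lia.
  rewrite !(expnD _ (8 * a)) mulnA; apply: leq_mul; last by case: k => // k; rewrite leq_exp2r.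
  by rewrite !expnM -expnMn; case: (a) => // b; rewrite leq_exp2r.
rewrite -(leq_pmul2r (_ : 0 < 3 ^ N * 2 ^ N)) ?muln_gt0 ?expn_gt0 //.
have e4 : 4 ^ N = 2 ^ N * 2 ^ N by rewrite -expnMn.
have e6 : 6 ^ a = 3 ^ a * 2 ^ a by rewrite -expnMn.
rewrite e4 in h; rewrite e6 in p6.
apply: (@leq_trans ((3 ^ a * (2 ^ N * 2 ^ N)) * (2 ^ a * 2 ^ N))).
  by rewrite [leqLHS](_ : _ = c * 3 ^ N * (2 ^ a * 2 ^ N)) ?leq_mul2r ?h ?orbT //; nia.
rewrite [leqLHS](_ : _ = (3 ^ a * 2 ^ a * 2 ^ N) * (2 ^ N * 2 ^ N)); last by nia.
rewrite [leqRHS](_ : _ = 3 ^ N * (2 ^ N * 2 ^ N)); last by nia.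
by rewrite leq_mul2r p6 orbT.
Qed.

(** * Territories of fat pairs *)

Lemma sum_card_disjoint (T I : finType) (J : {set I}) (B : I -> {set T}) (Y : {set T}) :
  (forall i, i \in J -> B i \subset Y) ->
  (forall i j, i \in J -> j \in J -> i != j -> [disjoint B i & B j]) ->
  \sum_(i in J) #|B i| <= #|Y|.
Proof.
move=> BY dB.
rewrite (eq_bigr (fun i => \sum_(x in Y) (x \in B i))); last first.
  move=> i iJ; rewrite -sum1_card big_mkcond [RHS]big_mkcond /=; apply: eq_bigr => x _.
  by case: ifP => [/(subsetP (BY i iJ)) -> | _] //; case: ifP.
rewrite exchange_big -sum1_card; apply: leq_sum => x _.
case: (boolP [exists i in J, x \in B i]) => [/exists_inP[i iJ xi] | /exists_inPn no].
  rewrite (bigD1 i) //= xi big1 // => j /andP[jJ ji].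
  by rewrite (disjointFl (dB j i jJ iJ ji)).
by rewrite big1 // => i iJ; rewrite (negPf (no i iJ)).
Qed.

Lemma ffact_geq_exp m k : (m - k) ^ k <= m ^_ k.
Proof.
case: k => [//|k]; have : forall j, j <= k.+1 -> (m - k.+1) ^ j <= m ^_ j; last exact.
elim=> [|j IH] hj; first by rewrite ffactn0.
rewrite ffactnSr expnSr leq_mul ?IH ?(ltnW hj) //.
by rewrite leq_sub2l // ltnW.
Qed.

(** A Bernoulli inequality, valid also for [a > n], where [n - a] is 0. *)
Lemma exp_sub_geq n a k : n ^ k.+1 <= (n - a) ^ k.+1 + k.+1 * a * n ^ k.
Proof.
elim: k => [|k IH]; first by rewrite !expn1 expn0; lia.
rewrite expnS; apply: (@leq_trans (n * (n - a) ^ k.+1 + k.+1 * a * n ^ k.+1)).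
  by rewrite [n ^ k.+1 in X in _ <= X]expnS; nia.
rewrite [in (n - a) ^ k.+2]expnS.
have : (n - a) ^ k.+1 <= n ^ k.+1 by rewrite leq_exp2r // leq_subr.
set x := (n - a) ^ k.+1; set y := n ^ k.+1 => xy.
have [h|h] := leqP a n; first by have -> : n * x = (n - a) * x + a * x; nia.
have -> : x = 0 by rewrite /x (_ : n - a = 0) ?exp0n //; lia.
nia.
Qed.

Lemma card_supersets (T : finType) (K W : {set T}) r :
  [disjoint K & W] -> #|K| <= r ->
  #|[set A : {set T} | [&& #|A| == r, K \subset A & A :\: K \subset W]]| =
  'C(#|W|, r - #|K|).
Proof.
move=> dKW hK; rewrite -cards_draws.
have inj : {in [set X : {set T} | X \subset W & #|X| == r - #|K|] &,
    injective (setU K)}.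
  have e (X : {set T}) : X \subset W -> (K :|: X) :\: K = X.
    move=> XW; rewrite setDUl setDv set0U; apply/setDidPl.
    by rewrite disjoint_sym; apply: disjointWr XW dKW.
  by move=> X Y; rewrite !inE => /andP[/e eX _] /andP[/e eY _] XY; rewrite -eX XY eY.
rewrite -(card_in_imset inj); congr #|pred_of_set _|; apply/setP => A.
rewrite inE; apply/and3P/imsetP => [[/eqP hA KA AW] | [X]].
  exists (A :\: K); last by rewrite -{1}(setID A K) (setIidPr KA).
  by rewrite inE AW cardsD (setIidPr KA) hA eqxx.
rewrite inE => /andP[XW /eqP hX] ->; split; first last.
- by rewrite setDUl setDv set0U (subset_trans (subsetDl _ _)).
- exact: subsetUl.
have := disjointWr XW dKW => /disjoint_setI0 KX.
by rewrite cardsU KX cards0 hX; lia.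
Qed.

Section Counting.
Variables (T : finType) (F : {set {set T}}) (r s t : nat).
Hypothesis F_unif : forall A, A \in F -> #|A| = r.
Hypothesis F_biclique_free : forall X Y : {set {set T}},
  X \subset F -> Y \subset F -> #|X| = t -> #|Y| = t ->
  ~ (forall A B, A \in X -> B \in Y -> #|A :&: B| = 1).
Hypothesis t_small : r + 2 * (r * t) <= s.
Hypothesis r_ge4 : 4 <= r.
Implicit Types A B K P Q X Y Z : {set T}.
Notation fat := (fat F s).
Notation good := (good_mem F r s).

Definition fat_pairs : {set {set T}} := [set P : {set T} | (#|P| == 2) && fat P].

Definition territory P : {set T} := [set x | (x \notin P) && fat (x |: P)].

Lemma fat_pairsP P : P \in fat_pairs -> #|P| = 2 /\ fat P.
Proof. by rewrite inE => /andP[/eqP-> ->]. Qed.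

Let inter K L : fat K -> fat L -> #|K| < 4 -> #|L| < 4 -> #|K :&: L| != 1.
Proof.
move=> fK fL hK hL; apply: (fat_inter F_unif F_biclique_free t_small) => //.
  exact: leq_trans r_ge4.
exact: leq_trans r_ge4.
Qed.

Lemma fat_pairs_disjoint P Q :
  P \in fat_pairs -> Q \in fat_pairs -> P != Q -> [disjoint P & Q].
Proof.
move=> /fat_pairsP[P2 fP] /fat_pairsP[Q2 fQ] PQ.
have := inter fP fQ; rewrite P2 Q2 => /(_ isT isT).
rewrite -setI_eq0 -cards_eq0 => h1.
have : #|P :&: Q| < 2.
  rewrite -P2 proper_card // properE subsetIl /= subsetI subxx /=.
  by apply: contra PQ => PQ; rewrite eqEcard PQ P2 Q2.
by case: #|_| h1 => [|[|k]].
Qed.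

Lemma card_add P x : #|P| = 2 -> x \notin P -> #|x |: P| = 3.
Proof. by move=> P2 xP; rewrite cardsU1 xP P2. Qed.

(** Since [P] and [Q] are disjoint, a common point [x] would be the whole intersection of two fat
    sets among [P], [Q], [x |: P], [x |: Q]. *)
Lemma territory_disjoint P Q : P \in fat_pairs -> Q \in fat_pairs -> P != Q ->
  [disjoint P :|: territory P & Q :|: territory Q].
Proof.
move=> PF QF PQ; have dPQ := fat_pairs_disjoint PF QF PQ.
have [P2 fP] := fat_pairsP PF; have [Q2 fQ] := fat_pairsP QF.
have mixed (R S : {set T}) x : [disjoint R & S] -> #|R| = 2 -> #|S| = 2 -> fat R ->
    x \in R -> x \in territory S -> False.
  move=> dRS R2 S2 fR xR; rewrite inE => /andP[xS fS].
  have := inter fR fS; rewrite R2 (card_add S2 xS) => /(_ isT isT).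
  rewrite (_ : R :&: (x |: S) = [set x]) ?cards1 //; apply/setP => y; rewrite !inE.
  case: eqP => [->|_] /=; first by rewrite xR.
  by apply/negP => /andP[yR yS]; rewrite (disjointFr dRS yR) in yS.
apply/pred0P => x /=; rewrite !in_setU; apply/negP => /andP[].
move=> /orP[xP|xP] /orP[xQ|xQ].
- by rewrite (disjointFr dPQ xP) in xQ.
- exact: mixed xP xQ.
- by apply: mixed xQ xP => //; rewrite disjoint_sym.
move: xP xQ; rewrite !inE => /andP[xP fxP] /andP[xQ fxQ].
have := inter fxP fxQ; rewrite !card_add // => /(_ isT isT).
rewrite (_ : (x |: P) :&: (x |: Q) = [set x]) ?cards1 //; apply/setP => y; rewrite !inE.
case: eqP => //= _; apply/negP => /andP[yP yQ].
by rewrite (disjointFr dPQ yP) in yQ.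
Qed.

Lemma good_structure_pairs A : good A ->
  (exists P, [/\ P \in fat_pairs, P \subset A & A :\: P \subset territory P]) \/
  (r = 4 /\ exists P Q,
     [/\ P \in fat_pairs, Q \in fat_pairs, P != Q & A = P :|: Q]).
Proof.
case/(good_structure F_unif F_biclique_free t_small r_ge4).
  move=> [P [fP P2 PA h]]; left; exists P; split=> //; first by rewrite inE P2 fP.
  by apply/subsetP => x; rewrite !inE => /andP[xP xA]; rewrite xP h.
move=> [r4 [P [Q [fP fQ P2 Q2 [dPQ eA]]]]]; right; split=> //; exists P, Q.
rewrite !inE fP fQ P2 Q2; split=> //; apply: contraTneq dPQ => ->.
by rewrite -setI_eq0 setIid -cards_eq0 Q2.
Qed.

(** [A] is covered by fat pairs inside it and their territories, and these pairs differ from [P]. *)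
Lemma good_disjoint A P : good A -> P \in fat_pairs -> ~~ (P \subset A) ->
  A \subset ~: (P :|: territory P).
Proof.
move=> gA PF PA; have dis Q : Q \in fat_pairs -> Q \subset A ->
    Q :|: territory Q \subset ~: (P :|: territory P).
  move=> QF QA; rewrite -disjoints_subset; apply: territory_disjoint => //.
  by apply: contraNneq PA => <-.
case: (good_structure_pairs gA) => [[Q [QF QA AQ]] | [_ [Q [R [QF RF _ eA]]]]].
  apply: subset_trans (dis Q QF QA); apply/subsetP => x xA; rewrite in_setU.
  by case: (boolP (x \in Q)) => //= xQ; apply: (subsetP AQ); rewrite inE xQ.
rewrite {1}eA subUset; apply/andP; split.
  by apply: subset_trans (dis Q QF _); rewrite ?subsetUl // eA subsetUl.
by apply: subset_trans (dis R RF _); rewrite ?subsetUl // eA subsetUr.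
Qed.

Lemma card_good_in Y w :
  (forall P, P \in fat_pairs -> P \subset Y -> #|territory P :&: Y| <= w) ->
  #|Y| <= 4 * w ->
  (r - 2)`! * #|[set A : {set T} | good A && (A \subset Y)]| <= w ^ (r - 3) * #|Y|.
Proof.
move=> hw hY; pose J := [set P in fat_pairs | P \subset Y].
pose b P := #|territory P :&: Y|.
pose star P := [set P :|: X | X in
  [set X : {set T} | X \subset territory P :&: Y & #|X| == r - 2]].
pose doubles := if r == 4 then
  [set cover D | D in [set D : {set {set T}} | D \subset J & #|D| == 2]] else set0.
have sumJ : \sum_(P in J) (b P + 2) <= #|Y|.
  rewrite (eq_bigr (fun P => #|P :|: (territory P :&: Y)|)); last first.
    move=> P; rewrite inE => /andP[/fat_pairsP[P2 _] _].
    rewrite cardsU (_ : _ :&: (_ :&: _) = set0) ?cards0 ?P2 ?subn0 1?addnC //.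
    by apply/setP => x; rewrite !inE; case: (x \in P).
  apply: sum_card_disjoint => [P|P Q]; first by rewrite inE subUset subsetIr andbT => /andP[].
  rewrite !inE => /andP[PF _] /andP[QF _] PQ.
  apply: disjointW (territory_disjoint _ _ PQ); rewrite ?inE //.
    by apply: setUS; apply: subsetIl.
  by apply: setUS; apply: subsetIl.
have hJ : #|J| <= 2 * w.
  have : \sum_(P in J) 2 <= #|Y|.
    by apply: leq_trans sumJ; apply: leq_sum => P _; apply: leq_addl.
  by rewrite sum_nat_const; lia.
have sub : [set A : {set T} | good A && (A \subset Y)] \subset
    (\bigcup_(P in J) star P) :|: doubles.
  apply/subsetP => A; rewrite inE => /andP[gA AY]; rewrite in_setU.
  have hA : #|A| = r by apply: F_unif; apply: good_memW gA.
  case: (good_structure_pairs gA) => [[P [PF PA AP]]|[r4 [P [Q [PF QF PQ eA]]]]].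
    apply/orP; left; apply/bigcupP; exists P.
      by rewrite inE PF (subset_trans PA).
    have [P2 _] := fat_pairsP PF.
    apply/imsetP; exists (A :\: P).
      rewrite inE subsetI AP (subset_trans (subsetDl _ _) AY).
      by rewrite cardsD (setIidPr PA) hA P2 eqxx.
    by apply/setP => x; rewrite !inE; case: (boolP (x \in P)) => [/(subsetP PA)|].
  apply/orP; right; rewrite /doubles r4 eqxx; apply/imsetP; exists [set P; Q].
    rewrite inE cards2 PQ eqxx andbT subUset !sub1set !inE.
    move: PF QF; rewrite !inE => -> -> /=; move: AY.
    by rewrite {1}eA subUset.
  by rewrite eA /cover bigcup_setU !big_set1.
apply: leq_trans (leq_mul (leqnn _) (subset_leq_card sub)) _.
apply: leq_trans (leq_mul (leqnn _) (leq_card_setU _ _ : _ <= _)) _.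
have e : r - 2 = (r - 3).+1 by lia.
have star_le : (r - 2)`! * #|\bigcup_(P in J) star P| <= \sum_(P in J) w ^ (r - 3) * b P.
  apply: leq_trans (leq_mul (leqnn _) (card_bigcup_leq _ _)) _.
  rewrite big_distrr /=; apply: leq_sum => P; rewrite inE => /andP[PF PY].
  apply: (@leq_trans ((r - 2)`! * 'C(b P, r - 2))).
    by rewrite leq_mul2l -cards_draws leq_imset_card orbT.
  rewrite mulnC bin_ffact; apply: leq_trans (ffact_leq_exp _ _) _.
  by rewrite e expnSr leq_mul2r leq_exp2r ?hw ?orbT //; lia.
(* For [r = 4] the power is [w], and [#|J| <= 2 * w] turns the square of [#|J|] into
   [2 * w * #|J|]. *)
have doubles_le : (r - 2)`! * #|doubles| <= \sum_(P in J) w ^ (r - 3) * 2.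
  rewrite /doubles; case: eqP => [->|_]; last by rewrite cards0 muln0.
  apply: (@leq_trans ((4 - 2)`! * 'C(#|J|, 2))).
    by rewrite leq_mul2l -cards_draws leq_imset_card orbT.
  rewrite mulnC bin_ffact sum_nat_const; apply: leq_trans (ffact_leq_exp _ _) _.
  by rewrite -mulnn leq_mul2l mulnC hJ orbT.
rewrite mulnDr; apply: leq_trans (leq_add star_le doubles_le) _.
rewrite -big_split /= (eq_bigr (fun P => w ^ (r - 3) * (b P + 2))) => [|P _];
  last by rewrite mulnDr.
by rewrite -big_distrr leq_mul2l sumJ orbT.
Qed.

End Counting.

Lemma exp_leq_mul_exp q b k : q < b -> 0 < k -> q ^ k <= q * b ^ k.
Proof.
case: k => // k qb _; rewrite expnS leq_mul2l; apply/orP; right.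
apply: (@leq_trans (b ^ k)); last by rewrite leq_pexp2l // (leq_ltn_trans _ qb).
by case: k => // k; rewrite leq_exp2r // ltnW.
Qed.

(** * The deterministic bound on an independent family *)

Section UpperBound.
Variables (T : finType) (F : {set {set T}}) (r s t : nat).
Hypothesis F_unif : forall A, A \in F -> #|A| = r.
Hypothesis F_biclique_free : forall X Y : {set {set T}},
  X \subset F -> Y \subset F -> #|X| = t -> #|Y| = t ->
  ~ (forall A B, A \in X -> B \in Y -> #|A :&: B| = 1).
Hypothesis t_small : r + 2 * (r * t) <= s.
Hypothesis r_ge4 : 4 <= r.
Implicit Types A B K P Q X Y Z : {set T}.
Notation fat := (fat F s).
Notation good := (good_mem F r s).

Let n := #|T|.
(** If [K] has three points, one of them in the [r]-set [B], then [K :|: B] has [r + 2] points, and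
    [N] counts the neighbours of [B] above [K]. *)
Let N := 'C(n - r.+2, r - 3).
Let f := (r - 2)`!.
Let beta := 2 ^ r * (s.+1 ^ r) ^ 3.

Definition star_of K : {set {set T}} := [set A : {set T} | (#|A| == r) && (K \subset A)].

(** What independence gives: the neighbours that [B] keeps above [K] are outside [F]. *)
Hypothesis F_misses : forall B K, B \in F -> #|K| = 3 -> #|K :&: B| = 1 ->
  N <= 8 * #|star_of K :\: F|.
Hypothesis n_large : 1024 * (r ^ 2 + f * beta + 1) <= n.
Hypothesis n_large' : 16 * f * (32 * (f * beta)) ^ r < n.

Lemma card_star_of K : #|K| <= r -> #|star_of K| = 'C(n - #|K|, r - #|K|).
Proof.
move=> hK; rewrite /n.
have <- : #|~: K| = #|T| - #|K| by rewrite -(cardsC K) addKn.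
rewrite -(@card_supersets _ K (~: K) r) //; last by rewrite -setI_eq0 setICr.
by congr #|pred_of_set _|; apply/setP => A; rewrite !inE setDE subsetIr andbT.
Qed.

Lemma card_mostly_good_in Y w (G : {set {set T}}) : G \subset F ->
  (forall A, A \in G -> good A -> A \subset Y) ->
  (forall P, P \in fat_pairs F s -> P \subset Y ->
     #|territory F s P :&: Y| <= w) ->
  #|Y| <= 4 * w ->
  f * #|G| <= w ^ (r - 3) * #|Y| + f * beta * n ^ (r - 3).
Proof.
move=> GF GY hw hY.
have sub : G \subset [set A | good A && (A \subset Y)] :|: [set A in F | ~~ good A].
  apply/subsetP => A AG; rewrite !inE (subsetP GF A AG) /=.
  by case: (boolP (good A)) => //= gA; rewrite GY.
apply: leq_trans (leq_mul (leqnn _) (subset_leq_card sub)) _.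
apply: leq_trans (leq_mul (leqnn _) (leq_card_setU _ _ : _ <= _)) _.
rewrite mulnDr leq_add //.
  exact: (card_good_in F_unif F_biclique_free t_small).
rewrite -mulnA leq_mul2l; apply/orP; right; rewrite mulnC.
by apply: (card_bad_mem s F_unif); lia.
Qed.

Let M := 'C(n - 2, r - 2).

(** [M] is [n ^ (r - 2)] over [f], up to an explicit lower-order error. *)
Let n_pow_M : n * n ^ (r - 3) <= f * M + r ^ 2 * n ^ (r - 3).
Proof.
have e : r - 2 = (r - 3).+1 by lia.
have := exp_sub_geq n r (r - 3); rewrite -e -expnS -e => h.
apply: leq_trans h _; apply: leq_add; last first.
  by rewrite leq_mul2r; apply/orP; right; rewrite -mulnn leq_mul2r leq_subr orbT.
rewrite [leqRHS]mulnC /f /M bin_ffact; apply: leq_trans (ffact_geq_exp _ _).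
by rewrite leq_exp2r; lia.
Qed.

Let n_pow_N : n ^ (r - 3) <= 2 * ((r - 3)`! * N).
Proof.
have e : r - 3 = (r - 4).+1 by lia.
have := exp_sub_geq n (2 * r) (r - 4); rewrite -e => h.
have h1 : (n - 2 * r) ^ (r - 3) <= (r - 3)`! * N.
  rewrite [leqRHS]mulnC /N bin_ffact; apply: leq_trans (ffact_geq_exp _ _).
  by rewrite leq_exp2r; lia.
have h2 : 2 * ((r - 3) * (2 * r) * n ^ (r - 4)) <= n ^ (r - 3).
  rewrite {2}e expnS mulnA leq_mul2r; apply/orP; right.
  apply: leq_trans n_large; rewrite -mulnn.
  by have := leq_mul (leq_subr 3 r) (leqnn r); lia.
lia.
Qed.

(** If all territories had at most [w] points, then [f * #|F|] would be at most
    [(w + f * beta) * n ^ (r - 3)]. By [n_pow_M] this is below [f * M], since [n - w] exceeds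
    [r ^ 2 + f * beta]. *)
Lemma exists_large_territory : M < #|F| ->
  exists2 P, P \in fat_pairs F s & 1024 * (n - #|territory F s P|) <= n.
Proof.
move=> MF; case: (boolP [exists P in fat_pairs F s,
    1024 * (n - #|territory F s P|) <= n]) => [/exists_inP[P PF hP]|/exists_inPn no].
  by exists P.
exfalso; pose w := n - n %/ 1024.
have hF : f * #|F| <= w ^ (r - 3) * #|[set: T]| + f * beta * n ^ (r - 3).
  apply: card_mostly_good_in => [|A _ _|P PF _|]; rewrite ?subsetT //.
    by have := no P PF; rewrite setIT /w; lia.
  by rewrite cardsT -/n /w; lia.
have e : r - 3 = (r - 4).+1 by lia.
have hw : w ^ (r - 3) * #|[set: T]| <= w * n ^ (r - 3).
  rewrite cardsT -/n {1}e expnS -mulnA leq_mul2l; apply/orP; right.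
  rewrite e expnSr leq_mul2r; apply/orP; right.
  have [->|?] := posnP (r - 4); first by [].
  by rewrite leq_exp2r // leq_subr.
have f0 : 0 < f by apply: fact_gt0.
have n0 : 0 < n ^ (r - 3) by rewrite expn_gt0; lia.
have fM : f * M < f * #|F| by rewrite ltn_mul2l f0.
have : n * n ^ (r - 3) < (w + f * beta + r ^ 2) * n ^ (r - 3).
  rewrite 2!mulnDl; lia.
rewrite ltn_mul2r n0 /= /w; lia.
Qed.

(** If [#|F| > M], more members lie outside the star of [P] than the star lacks: [mu < #|out|]. The
    set [Z] bounds [mu] from below linearly and [#|out|] from above, and the two bounds clash. *)
Theorem card_leq_bin : #|F| <= M.
Proof.
rewrite leqNgt; apply/negP => MF.
have [P PF hP] := exists_large_territory MF.
have [P2 fP] := fat_pairsP PF.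
have f0 : 0 < f by apply: fact_gt0.
have n0 : 0 < n ^ (r - 3) by rewrite expn_gt0; lia.
have e4 : r - 3 = (r - 4).+1 by lia.
have e3 : r - 2 = (r - 3).+1 by lia.
pose mu := #|star_of P :\: F|; pose out := F :\: star_of P.
have cardS : #|star_of P| = M by rewrite card_star_of P2 //; lia.
have out_mu : mu < #|out|.
  have := cardsID F (star_of P); have := cardsID (star_of P) F.
  by rewrite setIC cardS -/mu -/out; lia.
have outF : out \subset F by apply: subsetDl.
pose Z := [set x | (x \notin P) && (N <= 8 * #|star_of (x |: P) :\: F|)].
have card_add x : x \notin P -> #|x |: P| = 3 by move=> xP; rewrite cardsU1 xP P2.
(* Double counting: a missing member [A] of the star is counted at most once for each of the [r - 2]
   points of [A :\: P]. *)
have sumZ : \sum_(x in Z) #|star_of (x |: P) :\: F| <= (r - 2) * mu.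
  rewrite (eq_bigr (fun x => \sum_(A in star_of P :\: F) (x \in A))); last first.
    move=> x _; rewrite -sum1_card big_mkcond [RHS]big_mkcond /=; apply: eq_bigr => A _.
    rewrite !inE subUset sub1set; case: (A \in F) => //=.
    by case: (#|A| == r); case: (P \subset A); case: (x \in A).
  rewrite exchange_big mulnC -sum_nat_const; apply: leq_sum => A.
  rewrite !inE => /andP[_ /andP[/eqP hA PA]].
  rewrite -P2 -hA -(setIidPr PA) -cardsD -sum1_card big_mkcond [leqRHS]big_mkcond /=.
  apply: leq_sum => x _; rewrite !inE.
  by case: (x \in P); case: (x \in A); rewrite /= ?if_same //; case: ifP.
have qN : #|Z| * N <= 8 * ((r - 2) * mu).
  apply: leq_trans (leq_mul (leqnn 8) sumZ); rewrite big_distrr /= -sum_nat_const.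
  by apply: leq_sum => x; rewrite inE => /andP[].
have ef : f = (r - 2) * (r - 3)`! by rewrite /f e3 factS.
have q_mu : #|Z| * n ^ (r - 3) <= 16 * (f * mu).
  apply: leq_trans (leq_mul (leqnn _) n_pow_N) _.
  rewrite [leqLHS](_ : _ = 2 * (r - 3)`! * (#|Z| * N)); last by lia.
  apply: leq_trans (leq_mul (leqnn _) qN) _.
  by rewrite ef; lia.
have q_out : #|Z| * n ^ (r - 3) < 16 * (f * #|out|).
  by apply: leq_ltn_trans q_mu _; rewrite ltn_mul2l /= ltn_mul2l f0.
(* A first crude bound: good members of [out] avoid [P] and its territory, so they live on at most
   [n / 1024] points. *)
have hZ : 32 * #|Z| <= n.
  pose Y := ~: (P :|: territory F s P).
  have hY : #|Y| <= n - #|territory F s P|.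
    rewrite /n -(cardsC (P :|: territory F s P)) -/Y.
    by have := subset_leq_card (subsetUr P (territory F s P)); lia.
  have ho : f * #|out| <= #|Y| ^ (r - 3) * #|Y| + f * beta * n ^ (r - 3).
    apply: card_mostly_good_in => // [A|Q _ _|]; last by lia.
      rewrite !inE => /andP[nPA AF] gA.
      apply: (good_disjoint F_unif F_biclique_free t_small) => //.
      by move: nPA; rewrite F_unif // eqxx.
    by apply: subset_leq_card; apply: subsetIr.
  have hYn : #|Y| ^ (r - 3) <= n ^ (r - 3) by rewrite leq_exp2r ?max_card //; lia.
  have : #|Z| * n ^ (r - 3) < 16 * (#|Y| + f * beta) * n ^ (r - 3).
    apply: leq_trans q_out _; rewrite -mulnA leq_mul2l /=; apply: leq_trans ho _.
    by rewrite mulnDl leq_add2r mulnC leq_mul2l hYn orbT.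
  rewrite ltn_mul2r n0 /=; lia.
have outZ A : A \in out -> A \subset Z.
  rewrite !inE => /andP[nPA AF]; have hA := F_unif AF.
  rewrite hA eqxx /= in nPA.
  have key x : x \notin P -> #|(x |: P) :&: A| = 1 -> x \in Z.
    by move=> xP h; rewrite inE xP (F_misses AF) ?card_add.
  have dPA : [disjoint P & A].
    rewrite -setI_eq0 -cards_eq0; apply: contraT => PA0.
    have PA1 : #|P :&: A| = 1.
      have : #|P :&: A| < 2.
        by rewrite -P2 proper_card // properE subsetIl /= subsetI subxx.
      by case: #|_| PA0 => [|[]].
    (* If [A] met [P] in one point, every [x] outside both would lie in [Z], contrary to [hZ]. *)
    have : ~: (P :|: A) \subset Z.
      apply/subsetP => x; rewrite in_setC in_setU negb_or => /andP[xP xA].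
      apply: key => //; rewrite -PA1; congr #|pred_of_set _|; apply/setP => y.
      by rewrite !inE; case: eqP => // ->; rewrite (negPf xA) !andbF.
    move/subset_leq_card; have := cardsC (P :|: A); have := leq_card_setU P A => -[+ _].
    rewrite P2 hA -/n => h1 h2 h3; exfalso; move: hZ n_large h1 h2 h3.
    by rewrite -mulnn; clear; nia.
  apply/subsetP => x xA; have xP := disjointFl dPA xA.
  apply: key; rewrite ?xP //; rewrite (_ : _ :&: _ = [set x]) ?cards1 //.
  apply/setP => y; rewrite !inE; case: eqP => [->|_] /=; first by rewrite xA.
  by apply/negP => /andP[yP yA]; rewrite (disjointFr dPA yP) in yA.
have ho : f * #|out| <= #|Z| ^ (r - 3) * #|Z| + f * beta * n ^ (r - 3).
  apply: card_mostly_good_in => // [A AO _|Q _ _|]; [exact: outZ | | by lia].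
  by apply: subset_leq_card; apply: subsetIr.
have hZ2 : 32 * (#|Z| ^ (r - 3) * #|Z|) <= #|Z| * n ^ (r - 3).
  rewrite [leqRHS]mulnC mulnA leq_mul2r; apply/orP; right.
  rewrite e4 !expnS mulnA; apply: leq_mul => //.
  case: (posnP (r - 4)) => [->|r0] //; rewrite leq_exp2r //.
  by apply: leq_trans hZ; apply: leq_pmull.
(* By [hZ2] the main term of [ho], times 16, is at most half the left side of [q_out]; the bad
   members account for the other half. *)
have q_small : #|Z| < 32 * (f * beta).
  rewrite -(ltn_pmul2r n0) -mulnA.
  by move: q_out ho hZ2; clear; lia.
have out_q : #|out| <= #|Z| ^ r.
  apply: leq_trans (bin_leq_exp _ _); rewrite -cards_draws; apply: subset_leq_card.
  by apply/subsetP => A AO; rewrite inE outZ //= F_unif // (subsetP outF).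
have r0 : 0 < r by lia.
have q0 : 0 < #|Z|.
  by case: (posnP #|Z|) out_q => // ->; rewrite exp0n // leqNgt (leq_ltn_trans _ out_mu).
have q_B := exp_leq_mul_exp q_small r0.
(* Now [Z] is so small that counting all [r]-subsets of [Z] suffices against [n_large']. *)
have : #|Z| * n < #|Z| * (16 * f * (32 * (f * beta)) ^ r).
  apply: (@leq_ltn_trans (#|Z| * n ^ (r - 3))).
    by rewrite leq_mul2l e4 expnS leq_pmulr ?orbT // expn_gt0; lia.
  apply: leq_trans q_out _; have out_B := leq_trans out_q q_B.
  move: out_B; move: ((32 * (f * beta)) ^ r) => b ob.
  by rewrite [leqRHS]mulnC -!mulnA !leq_mul2l [leqRHS]mulnC ob !orbT.
by rewrite ltn_mul2l q0 /= ltnNge (ltnW n_large').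
Qed.

End UpperBound.

(** * The random subgraph *)

(** Evaluated at about [log n], such functions are polylogarithmic. The base [l.+1] is positive, so
    exponents can be raised. *)
Definition poly_bounded (g : nat -> nat) : Prop :=
  exists C e, forall l, g l <= C * l.+1 ^ e.

Lemma poly_bounded_const c : poly_bounded (fun=> c).
Proof. by exists c, 0 => l; rewrite muln1. Qed.

Lemma poly_bounded_id : poly_bounded id.
Proof. by exists 1, 1 => l; rewrite mul1n expn1. Qed.

Lemma poly_bounded_add g h :
  poly_bounded g -> poly_bounded h -> poly_bounded (fun l => g l + h l).
Proof.
move=> [C [e hg]] [C' [e' hh]]; exists (C + C'), (e + e') => l.
rewrite mulnDl leq_add //.
  by apply: leq_trans (hg l) _; rewrite leq_mul2l leq_pexp2l ?leq_addr ?orbT.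
by apply: leq_trans (hh l) _; rewrite leq_mul2l leq_pexp2l ?leq_addl ?orbT.
Qed.

Lemma poly_bounded_mul g h :
  poly_bounded g -> poly_bounded h -> poly_bounded (fun l => g l * h l).
Proof.
move=> [C [e hg]] [C' [e' hh]]; exists (C * C'), (e + e') => l.
by rewrite expnD mulnACA leq_mul.
Qed.

Lemma poly_bounded_exp g k : poly_bounded g -> poly_bounded (fun l => g l ^ k).
Proof.
move=> [C [e hg]]; exists (C ^ k), (e * k) => l.
by rewrite expnM -expnMn; case: k => // k; rewrite leq_exp2r.
Qed.

(** With [l] the logarithm and [k = l %/ e.+1], the factor [l.+2 ^ e] costs a constant times
    [2 ^ (k * e)]; one more factor [2 ^ k] absorbs the constant [D]. *)
Lemma poly_bounded_trunc_log g : poly_bounded g ->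
  exists m, forall n, m <= n -> g (trunc_log 2 n).+1 < n.
Proof.
move=> [C [e hg]]; pose D := C * (2 * e.+1) ^ e; exists (2 ^ (e.+1 * D)) => n hn.
have n0 : 0 < n by apply: leq_trans hn; rewrite expn_gt0.
have hl : e.+1 * D <= trunc_log 2 n by apply: trunc_log_max.
have /andP[hln _] := trunc_log_bounds (isT : 1 < 2) n0.
apply: leq_trans hln.
move: (trunc_log 2 n) hl => l hl; apply: leq_ltn_trans (hg _) _.
pose k := l %/ e.+1.
have kl : e.+1 * k <= l by rewrite mulnC leq_trunc_div.
have lk : l.+2 <= e.+1 * k.+2.
  have := ltn_ceil l (isT : 0 < e.+1); rewrite -/k mulnC !mulnS => h.
  by rewrite (leq_ltn_trans h) //; clear; lia.
have Dk : D < 2 ^ k.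
  apply: leq_ltn_trans (ltn_expl k (isT : 1 < 2)).
  by rewrite leq_divRL // mulnC.
apply: (@leq_trans (2 ^ (e.+1 * k))); last by rewrite leq_exp2l.
have k2 : k.+2 <= 2 * 2 ^ k.
  by have := ltn_expl k (isT : 1 < 2); move: (2 ^ k) => x; clear; lia.
have : C * l.+2 ^ e <= D * (2 ^ k) ^ e.
  rewrite /D -mulnA leq_mul2l -expnMn; apply/orP; right.
  have : l.+2 <= 2 * e.+1 * 2 ^ k.
    by apply: leq_trans lk _; rewrite [2 * _]mulnC -mulnA leq_mul2l k2 orbT.
  by case: (e) => // e' h; rewrite leq_exp2r.
move/leq_ltn_trans; apply.
by rewrite mulSn expnD -expnM [k * e]mulnC ltn_mul2r expn_gt0 /=.
Qed.

(** Linear growth is enough, as the binomial only has to beat a multiple of [log n]. *)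
Lemma bin_geq_sub m k : k <= m -> m - k <= 'C(m, k.+1).
Proof.
elim: m => [|m IH] km; first by rewrite sub0n.
have [h|h] := leqP k m; last by rewrite (eqP (_ : m.+1 - k == 0)) // subn_eq0.
have : 0 < 'C(m, k) by rewrite bin_gt0.
by have := IH h; rewrite binS; lia.
Qed.

Lemma eq_set2 (T : finType) (a b c d : T) : [set a; b] = [set c; d] ->
  (a = c /\ b = d) \/ (a = d /\ b = c).
Proof.
move/setP => h.
have := h a; have := h b; have := h c; have := h d; rewrite !inE !eqxx /= !orbT.
move=> /orP[]/eqP hd /orP[]/eqP hc /esym/orP[]/eqP hb /esym/orP[]/eqP ha; subst; auto.
Qed.

(** * Union bounds for the two bad events, and the independence number outside them *)

Section RandomSubgraph.
Variables (n r : nat).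
Hypothesis r_ge4 : 4 <= r.
Notation V := (Kvert n r).
Notation E := (Kedges n r).
Implicit Types (A B K : {set 'I_n}) (X Y F : {set {set 'I_n}}).
Implicit Types S : {set {set {set 'I_n}}}.

Lemma edge_mem A B : A \in V -> B \in V -> #|A :&: B| = 1 -> [set A; B] \in E.
Proof.
move=> AV BV h; apply/imset2P; exists A B => //.
by rewrite inE BV h eqxx.
Qed.

Lemma edge_inter A B : A \in V -> [set A; B] \in E -> #|A :&: B| = 1.
Proof.
rewrite inE => /eqP hA /imset2P[A' B' _]; rewrite inE => /andP[_ /eqP h] e.
by case: (eq_set2 e) => -[-> ->] //; rewrite setIC.
Qed.

Definition crossing X Y : {set {set {set 'I_n}}} := [set [set A; B] | A in X, B in Y].

Definition adjacent_sets t X Y : bool :=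
  [&& X \subset V, Y \subset V, #|X| == t, #|Y| == t
    & [forall A in X, forall B in Y, #|A :&: B| == 1]].

Definition has_empty_biclique t S : bool :=
  [exists X, exists Y, adjacent_sets t X Y && (S :&: crossing X Y == set0)].

Lemma crossing_sub t X Y : adjacent_sets t X Y -> crossing X Y \subset E.
Proof.
case/and5P => XV YV _ _ /forall_inP h; apply/subsetP => _ /imset2P[A B AX BY ->].
apply: edge_mem; [exact: subsetP XV _ AX | exact: subsetP YV _ BY | ].
by move/forall_inP: (h A AX) => /(_ B BY)/eqP.
Qed.

(** Different pairs give different edges: a swapped coincidence would make [A] its own neighbour,
    although [#|A :&: A| = r]. *)
Lemma card_crossing t X Y : adjacent_sets t X Y -> #|crossing X Y| = t * t.
Proof.
case/and5P => XV YV /eqP hX /eqP hY /forall_inP h.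
rewrite /crossing curry_imset2X card_in_imset ?cardsX ?hX ?hY //.
move=> [A B] [A' B']; rewrite !inE /= => /andP[AX BY] /andP[AX' BY'] /eq_set2[[-> ->] //|].
move=> [eA eB]; have /forall_inP/(_ B' BY') := h A AX.
by rewrite -eA setIid; have := subsetP XV A AX; rewrite inE => /eqP->; lia.
Qed.

(** At most [n ^ (2 * r * t)] pairs [X], [Y], each losing all its [t * t] edges with probability
    [2 ^ - (t * t)]. The hypothesis raised to the power [t] leaves a probability of at most
    [1 / n]. *)
Lemma card_has_empty_biclique t : 0 < t -> n ^ (2 * r).+1 <= 2 ^ t ->
  #|[set S in powerset E | has_empty_biclique t S]| * n <= 2 ^ #|E|.
Proof.
move=> t0 ht; have [n0 | n0] := posnP n; first by rewrite [X in _ * X]n0 muln0.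
set bad := [set _ in _ | _].
pose J := [set X : {set {set 'I_n}} | X \subset V & #|X| == t].
have hJ : #|J| <= n ^ (r * t).
  rewrite cards_draws; apply: leq_trans (bin_leq_exp _ _) _.
  rewrite expnM; case: (t) => // k; rewrite leq_exp2r //.
  by rewrite /V card_draws card_ord bin_leq_exp.
have sub : bad \subset \bigcup_(p in setX J J | adjacent_sets t p.1 p.2)
    [set S in powerset E | S :&: crossing p.1 p.2 == set0].
  apply/subsetP => S; rewrite !inE => /andP[SE /existsP[X /existsP[Y /andP[XY e]]]].
  apply/bigcupP; exists (X, Y); last by rewrite !inE SE.
  by rewrite !inE XY; case/and5P: XY => -> -> -> -> _.
have hbad : #|bad| * 2 ^ (t * t) <= n ^ (2 * r * t) * 2 ^ #|E|.
  apply: leq_trans (leq_mul (subset_leq_card sub) (leqnn _)) _.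
  apply: leq_trans (leq_mul (card_bigcup_leq _ _) (leqnn _)) _.
  rewrite big_distrl /=.
  apply: (@leq_trans (\sum_(p in setX J J) 2 ^ #|E|)).
    rewrite [leqRHS](bigID (fun p => adjacent_sets t p.1 p.2)) /=.
    apply: leq_trans (leq_addr _ _); apply: leq_sum => -[X Y] /= /andP[_ XY].
    rewrite (card_subsets_by_trace (fun S => S == set0) (crossing_sub XY)).
    have := subset_leq_card (crossing_sub XY); rewrite (card_crossing XY) => le.
    rewrite -mulnA -expnD subnK // -{2}[2 ^ _]mul1n leq_mul2r; apply/orP; right.
    rewrite -(cards1 (set0 : {set {set {set 'I_n}}})); apply: subset_leq_card.
    by apply/subsetP => S; rewrite !inE => /andP[_].
  rewrite sum_nat_const cardsX leq_mul2r; apply/orP; right.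
  by rewrite -mulnA mul2n -addnn expnD leq_mul.
have hn : n ^ (2 * r * t) * n <= 2 ^ (t * t).
  apply: (@leq_trans ((n ^ (2 * r).+1) ^ t)); last first.
    by rewrite expnM; case: (t) ht => // k h; rewrite leq_exp2r.
  have nt : n <= n ^ t by rewrite -{1}[n]expn1 leq_pexp2l.
  by rewrite -expnM mulSn expnD [leqLHS]mulnC leq_mul2r nt orbT.
have p0 : 0 < n ^ (2 * r * t) by rewrite expn_gt0 n0.
rewrite -(leq_pmul2l p0); apply: leq_trans hbad.
by rewrite mulnCA leq_mul2l hn orbT.
Qed.

Definition nbrs S K B : {set {set 'I_n}} :=
  [set A : {set 'I_n} in star_of r K | [set A; B] \in S].

Definition has_low_degree S : bool :=
  [exists K : {set 'I_n}, exists B : {set 'I_n},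
    [&& #|K| == 3, #|B| == r, #|K :&: B| == 1 &
      8 * #|nbrs S K B| < 'C(n - r.+2, r - 3)]].

(** For each of at most [n ^ r.+3] pairs [K], [B], [card_eighth_tail] applies to the [N] distinct
    edges from [B] to the sets in [ext K B]. *)
Lemma card_has_low_degree : n ^ r.+4 <= 2 ^ ('C(n - r.+2, r - 3).-1 %/ 8) ->
  #|[set S in powerset E | has_low_degree S]| * n <= 2 ^ #|E|.
Proof.
set N := 'C(_, _) => hN; have [n0 | n0] := posnP n; first by rewrite [X in _ * X]n0 muln0.
set bad := [set _ in _ | _].
pose J := setX [set K : {set 'I_n} | #|K| == 3] [set B : {set 'I_n} | #|B| == r].
pose ext (K B : {set 'I_n}) :=
  [set A : {set 'I_n} | [&& #|A| == r, K \subset A & A :\: K \subset ~: (K :|: B)]].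
pose E0 (p : {set 'I_n} * {set 'I_n}) := [set [set A; p.2] | A in ext p.1 p.2].
have hJ : #|J| <= n ^ r.+3.
  rewrite cardsX !card_draws card_ord (_ : r.+3 = 3 + r) // expnD.
  by rewrite leq_mul ?bin_leq_exp.
have extI K B A : A \in ext K B -> A :&: B = K :&: B.
  rewrite inE => /and3P[_ KA AK]; apply/eqP; rewrite eqEsubset [X in _ && X]setSI // andbT.
  apply/subsetP => x; rewrite !inE => /andP[xA xB]; rewrite xB andbT.
  apply: contraT => xK; have := subsetP AK x; rewrite !inE xK xA xB orbT.
  by move=> /(_ isT).
have E0sub p : p \in J -> #|p.1 :&: p.2| == 1 -> E0 p \subset E.
  case: p => K B; rewrite !inE /= => /andP[_ hB] /eqP h1.
  apply/subsetP => _ /imsetP[A Aext ->]; apply: edge_mem; rewrite ?inE //.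
    by move: Aext; rewrite inE => /and3P[].
  by rewrite (extI _ _ _ Aext).
have E0card p : p \in J -> #|p.1 :&: p.2| == 1 -> #|E0 p| = N.
  case: p => K B; rewrite !inE /= => /andP[/eqP hK /eqP hB] /eqP h1.
  rewrite card_in_imset /= => [|A A' Aext _ /eq_set2[[]//|[eA _]]]; last first.
    by have := extI _ _ _ Aext; rewrite eA setIid => e; move: h1 r_ge4; rewrite -e hB => ->.
  rewrite card_supersets ?hK //; last by rewrite ltnW.
    have := cardsC (K :|: B); rewrite cardsU hK hB h1 card_ord => e.
    by congr 'C(_, _); move: e; clear; lia.
  by rewrite -setI_eq0; apply/eqP/setP => x; rewrite !inE; case: (x \in K).
have sub : bad \subset \bigcup_(p in J | #|p.1 :&: p.2| == 1)
    [set S in powerset E | 8 * #|S :&: E0 p| < #|E0 p|].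
  apply/subsetP => S; rewrite !inE.
  case/andP => SE /existsP[K /existsP[B /and4P[hK hB h1 low]]].
  have pJ : (K, B) \in J by rewrite !inE hK hB.
  apply/bigcupP; exists (K, B); first by rewrite pJ.
  rewrite !inE SE (E0card _ pJ h1) /=; apply: leq_ltn_trans low.
  rewrite leq_mul2l /=; apply: (@leq_trans #|[set [set A; B] | A in nbrs S K B]|).
    apply: subset_leq_card; apply/subsetP => e; rewrite inE => /andP[eS /imsetP[A]].
    rewrite inE => /and3P[hA KA _] ee; apply/imsetP; exists A => //.
    by rewrite !inE hA KA /= -ee.
  exact: leq_imset_card.
have hbad : #|bad| * 2 ^ (N.-1 %/ 8) <= n ^ r.+3 * 2 ^ #|E|.
  apply: leq_trans (leq_mul (subset_leq_card sub) (leqnn _)) _.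
  apply: leq_trans (leq_mul (card_bigcup_leq _ _) (leqnn _)) _.
  rewrite big_distrl /=.
  apply: (@leq_trans (\sum_(p in J) 2 ^ #|E|)).
    rewrite [leqRHS](bigID (fun p => #|p.1 :&: p.2| == 1)) /=.
    apply: leq_trans (leq_addr _ _); apply: leq_sum => p /andP[pJ h1].
    rewrite (card_subsets_by_trace (fun S => 8 * #|S| < #|E0 p|) (E0sub p pJ h1)).
    have le := subset_leq_card (E0sub p pJ h1).
    rewrite mulnAC; apply: (@leq_trans (2 ^ #|E0 p| * 2 ^ (#|E| - #|E0 p|))).
      by rewrite leq_mul2r -(E0card p pJ h1) card_eighth_tail orbT.
    by rewrite -expnD subnKC.
  by rewrite sum_nat_const leq_mul2r hJ orbT.
have p0 : 0 < n ^ r.+3 by rewrite expn_gt0 n0.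
rewrite -(leq_pmul2l p0); apply: leq_trans hbad.
by rewrite mulnCA -expnSr leq_mul2l hN orbT.
Qed.

Lemma alpha_geq_bin S : 2 <= n -> S \subset E -> 'C(n - 2, r - 2) <= alpha r S.
Proof.
move=> n2 SE.
have [|P [_ _ P2]] := @exists_subset_card _ [set: 'I_n] set0 2 (sub0set _).
  by rewrite cards0 cardsT card_ord.
have <- : #|star_of r P| = 'C(n - 2, r - 2).
  by rewrite card_star_of ?P2 ?card_ord // (leq_trans _ r_ge4).
have starV : star_of r P \subset V.
  by apply/subsetP => A; rewrite !inE => /andP[].
apply: (leq_bigmax_cond (F := fun I => #|pred_of_set I|)).
rewrite /indep starV /=; apply/forall_inP => A Astar; apply/forall_inP => B Bstar.
apply/negP => /(subsetP SE) /(edge_inter (subsetP starV A Astar)) h.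
have : P \subset A :&: B.
  by move: Astar Bstar; rewrite !inE subsetI => /andP[_ ->] /andP[_ ->].
by move/subset_leq_card; rewrite P2 h.
Qed.

(** Independence of [F] turns the absence of the two bad events into the hypotheses of
    [card_leq_bin]. *)
Lemma alpha_leq_bin t s S : let f := (r - 2)`! in let beta := 2 ^ r * (s.+1 ^ r) ^ 3 in
  S \subset E -> ~~ has_empty_biclique t S -> ~~ has_low_degree S ->
  r + 2 * (r * t) <= s ->
  1024 * (r ^ 2 + f * beta + 1) <= n ->
  16 * f * (32 * (f * beta)) ^ r < n ->
  alpha r S <= 'C(n - 2, r - 2).
Proof.
move=> f beta SE nbic nlow ts n1 n2; apply/bigmax_leqP => F /andP[FV /forall_inP Findep].
have Fnot A B : A \in F -> B \in F -> [set A; B] \notin S.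
  by move=> AF BF; move/forall_inP: (Findep A AF); apply.
rewrite -[X in 'C(X - 2, _)](card_ord n).
apply: (@card_leq_bin _ F r s t) => //; rewrite ?card_ord //.
- by move=> A /(subsetP FV); rewrite inE => /eqP.
- move=> X Y XF YF hX hY h; case/negP: nbic.
  apply/existsP; exists X; apply/existsP; exists Y; apply/andP; split.
    rewrite /adjacent_sets hX hY !eqxx (subset_trans XF) ?(subset_trans YF) //=.
    by apply/forall_inP => A AX; apply/forall_inP => B BY; rewrite h.
  apply/eqP/setP => e; rewrite !inE; apply/negP => /andP[eS /imset2P[A B AX BY ee]].
  by have := Fnot A B (subsetP XF A AX) (subsetP YF B BY); rewrite -ee eS.
move=> B K BF hK h1; rewrite leqNgt; apply/negP => low; case/negP: nlow.
apply/existsP; exists K; apply/existsP; exists B.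
rewrite hK h1 !eqxx /=; have := subsetP FV B BF; rewrite inE => -> /=.
apply: leq_ltn_trans low; rewrite leq_mul2l /=; apply: subset_leq_card.
apply/subsetP => A; rewrite inE => /andP[Astar AB]; rewrite inE Astar andbT.
by apply: contraL AB => AF; apply: Fnot.
Qed.

End RandomSubgraph.

(** * Convergence of the probability to 1 *)

Unset Implicit Arguments.
Local Open Scope ring_scope.

Theorem theorem4 (r : nat) (hr : (4 <= r)%N) :
  forall eps : rat, 0 < eps ->
  exists N : nat, forall n : nat, (r <= n)%N -> (N <= n)%N ->
    1 - eps <= prob_alpha_eq n r.
Proof.
move=> eps eps0.
(* For [n < 2 ^ l] this [t] gives [n ^ (2 * r).+1 <= 2 ^ t]; [c1] and [c2] are the size conditions
   of [alpha_leq_bin], and [c3] makes [N] large enough for [card_has_low_degree]. *)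
pose t l := ((2 * r).+1 * l)%N; pose s l := (r + 2 * (r * t l))%N.
pose f := ((r - 2)`!)%N; pose beta l := (2 ^ r * ((s l).+1 ^ r) ^ 3)%N.
pose c1 l := (1024 * (r ^ 2 + f * beta l + 1))%N.
pose c2 l := (16 * f * (32 * (f * beta l)) ^ r)%N.
pose c3 l := (8 * (r.+4 * l) + 2 * r)%N.
have [m hm] : exists m : nat, forall n, (m <= n)%N ->
    (c1 (trunc_log 2 n).+1 + c2 (trunc_log 2 n).+1 + c3 (trunc_log 2 n).+1 < n)%N.
  apply: (poly_bounded_trunc_log (g := fun l => c1 l + c2 l + c3 l)%N).
  have pt : poly_bounded t.
    by apply: poly_bounded_mul; [exact: poly_bounded_const|exact: poly_bounded_id].
  have ps : poly_bounded s.
    apply: poly_bounded_add; first exact: poly_bounded_const.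
    apply: poly_bounded_mul; first exact: poly_bounded_const.
    by apply: poly_bounded_mul => //; exact: poly_bounded_const.
  have pf : poly_bounded (fun l => f * beta l)%N.
    apply: poly_bounded_mul; first exact: poly_bounded_const.
    apply: poly_bounded_mul; first exact: poly_bounded_const.
    apply: (poly_bounded_exp (g := fun l => (s l).+1 ^ r)%N).
    apply: (poly_bounded_exp (g := fun l => (s l).+1)).
    exact: (poly_bounded_add (poly_bounded_const 1) ps).
  apply: poly_bounded_add; first apply: poly_bounded_add.
  - apply: poly_bounded_mul; first exact: poly_bounded_const.
    apply: poly_bounded_add; last exact: poly_bounded_const.
    by apply: poly_bounded_add => //; exact: poly_bounded_const.
  - apply: poly_bounded_mul; first exact: poly_bounded_const.
    apply: poly_bounded_exp.
    by apply: poly_bounded_mul => //; exact: poly_bounded_const.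
  apply: poly_bounded_add; last exact: poly_bounded_const.
  apply: poly_bounded_mul; first exact: poly_bounded_const.
  by apply: poly_bounded_mul; [exact: poly_bounded_const|exact: poly_bounded_id].
(* Each bad event has probability at most [1 / n], so [2 / n <= eps] suffices. *)
exists (maxn m (Num.bound (2 / eps))) => n hrn; rewrite geq_max => /andP[hmn hbn].
have := hm n hmn; have := trunc_log_ltn n (isT : (1 < 2)%N).
move: (trunc_log 2 n).+1 (ltn0Sn (trunc_log 2 n)) => l l0 nl hc.
have [h1 h2 h3] : [/\ c1 l <= n, c2 l < n & c3 l <= n]%N.
  by move: (c1 l) (c2 l) (c3 l) hc => x y z hc; split; lia.
have n2l k : (n ^ k <= 2 ^ (k * l))%N.
  by rewrite mulnC expnM; case: k => // k; rewrite leq_exp2r // ltnW.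
have bic : (#|[set S in powerset (Kedges n r) | has_empty_biclique r (t l) S]| * n
    <= 2 ^ #|Kedges n r|)%N.
  by apply: card_has_empty_biclique; rewrite ?muln_gt0 ?l0 ?n2l.
have low : (#|[set S in powerset (Kedges n r) | has_low_degree r S]| * n
    <= 2 ^ #|Kedges n r|)%N.
  apply: card_has_low_degree => //; apply: leq_trans (n2l _) _; rewrite leq_exp2l //.
  have := @bin_geq_sub (n - r.+2) (r - 4); have -> : ((r - 4).+1 = r - 3)%N by lia.
  by rewrite leq_divRL // => h; move: h3 h; rewrite /c3; lia.
pose ok := [set S in powerset (Kedges n r) | alpha r S == alpha r (Kedges n r)].
have cover : (2 ^ #|Kedges n r| <=
    #|ok| + (#|[set S in powerset (Kedges n r) | has_empty_biclique r (t l) S]| +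
             #|[set S in powerset (Kedges n r) | has_low_degree r S]|))%N.
  rewrite -card_powerset.
  apply: leq_trans (leq_add (leqnn _) (leq_card_setU _ _ : (_ <= _)%N)).
  apply: leq_trans (leq_card_setU _ _ : (_ <= _)%N); apply: subset_leq_card.
  apply/subsetP => S SE; rewrite !inE -powersetE SE /=.
  case: (boolP (has_empty_biclique r (t l) S)) => [|nbic]; first by rewrite orbT.
  case: (boolP (has_low_degree r S)) => [|nlow]; first by rewrite !orbT.
  rewrite powersetE in SE.
  have up : (alpha r S <= 'C(n - 2, r - 2))%N.
    by apply: (@alpha_leq_bin n r hr (t l) (s l)).
  (* Deleting edges keeps independent sets independent; with [up] and [alpha_geq_bin] this closes
     the chain of inequalities. *)
  have mono : (alpha r (Kedges n r) <= alpha r S)%N.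
    apply/bigmax_leqP => I /andP[IV /forall_inP h].
    apply: (leq_bigmax_cond (F := fun I : {set {set 'I_n}} => #|I|)).
    rewrite /indep IV; apply/forall_inP => A AI; apply/forall_inP => B BI.
    by apply: contra (forall_inP (h A AI) B BI); apply: (subsetP SE).
  rewrite !orbF eqn_leq mono andbT (leq_trans up) //.
  by apply: alpha_geq_bin => //; lia.
have n0 : (0 < n)%N by lia.
have key : (2 ^ #|Kedges n r| * n <= #|ok| * n + 2 * 2 ^ #|Kedges n r|)%N.
  apply: leq_trans (leq_mul cover (leqnn n)) _; rewrite mulnDl leq_add2l mulnDl.
  by rewrite mul2n -addnn leq_add.
rewrite /prob_alpha_eq -/ok.
set p := (2 ^ #|Kedges n r|)%N in key *.
have p0 : (0 < p%:R :> rat) by rewrite ltr0n expn_gt0.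
have n0' : (0 < n%:R :> rat) by rewrite ltr0n.
rewrite ler_pdivlMr // mulrBl mul1r lerBlDr -(ler_pM2r n0').
have key' : p%:R * n%:R <= #|ok|%:R * n%:R + 2 * p%:R :> rat.
  by rewrite -!natrM -natrD ler_nat.
apply: le_trans key' _; rewrite [leRHS]mulrDl lerD2l [leRHS]mulrAC ler_pM2r //.
have b0 : 0 <= 2 / eps by rewrite divr_ge0 // ltW.
have := archi_boundP b0; rewrite ltr_pdivrMr // => /ltW/le_trans; apply.
by rewrite mulrC ler_pM2l // ler_nat.
Qed.
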